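(* Let $w$ be any finite word in the letters $\tilde T,\tilde R$. Then $w(F_0)$, where $F_0=\sum_{j\ge0}UP[j,0]$, can be written in quiver form, i.e. there exist $m,n\ge0$, vectors $S,A\in\mathbb{Z}^{m+n}$, a symmetric matrix $Q\in\mathbb{Z}^{(m+n)\times(m+n)}$ and a type $X\in\{UP,OP,RI\}$ such that $$w(F_0)=\sum_{\mathbf d\in\mathbb{N}^{m+n}}(-q)^{S\cdot\mathbf d}a^{A\cdot\mathbf d}q^{\mathbf d^TQ\mathbf d}{|\mathbf d|\brack d_1,\dots,d_{m+n}}X[\,|\mathbf d|,\,d_1+\cdots+d_m\,].$$
   Context: Notation: $(x;q^2)_n=\prod_{i=0}^{n-1}(1-xq^{2i})$; ${N\brack b_1,\dots,b_m}=\frac{(q^2;q^2)_N}{\prod(q^2;q^2)_{b_i}}$ for $\sum b_i=N$; ${N\brack k}_+={N\brack k,N-k}$; $|\mathbf d|=d_1+\cdots+d_{m+n}$. Formal skein setup: symbols $X[j,k]$ for $X\in\{UP,OP,RI\}$ and integers $0\le k\le j$ are linearly independent; $\mathcal M$ is the set of formal sums $\sum_{j\ge0}\sum_X\sum_{k=0}^jc_{X,j,k}X[j,k]$ with coefficients in $\mathbb{Q}(a,q)$ (any expression as on the right-hand side above defines such an element by collecting terms, since for fixed $j$ there are finitely many $\mathbf d$ with $|\mathbf d|=j$). (They model the basis webs of the $j$-colored HOMFLY-PT skein module of 4-ended tangles with boundary orientation $X$.) Linear operators $T,R$ (top/right twist) are defined, for fixed $j$, by $T\,UP[j,k]=\sum_{h=k}^j(-q)^{h-j}q^{k^2}{h\brack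 k}_+UP[j,h]$; $R\,UP[j,k]=\sum_{h=0}^k(-q)^{h-j}a^{h-j}q^{-2kh+k^2+j^2}{j-h\brack k-h}_+OP[j,h]$; $T\,OP[j,k]=\sum_{h=k}^j(-q)^ha^kq^{k^2-2jk}{h\brack k}_+RI[j,h]$; $R\,OP[j,k]=\sum_{h=0}^k(-q)^{h-j}a^{k-j}q^{2h(j-k)+(k-j)^2}{j-h\brack k-h}_+UP[j,h]$; $T\,RI[j,k]=\sum_{h=k}^j(-q)^ha^hq^{k^2-2jh}{h\brack k}_+OP[j,h]$; $R\,RI[j,k]=\sum_{h=0}^k(-q)^hq^{h(2j-2k)+k^2-j^2}{j-h\brack k-h}_+RI[j,h]$, extended termwise. Rescaling $\rho(X[j,k])={j\brack k}_+X[j,k]$; rescaled twists $\tilde T=\rho T\rho^{-1}$, $\tilde R=\rho R\rho^{-1}$. The indices $d_1,\dots,d_m$ are called active and $d_{m+1},\dots,d_{m+n}$ inactive. *)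

(* Defs.v *)
From HB Require Import structures.
From mathcomp Require Import all_boot all_order all_algebra.
Set Implicit Arguments. Unset Strict Implicit. Unset Printing Implicit Defensive.
Import Order.TTheory GRing.Theory Num.Theory.
Local Open Scope ring_scope.

Definition Kaq : fieldType := {fraction {poly {poly rat}}}.
Definition qv : Kaq := FracField.tofrac (('X : {poly rat})%:P).
Definition av : Kaq := FracField.tofrac ('X : {poly {poly rat}}).

Definition qpoch (n : nat) : Kaq := \prod_(i < n) (1 - qv ^+ (2 * i.+1)).
Definition qbin (N k : nat) : Kaq := qpoch N / (qpoch k * qpoch (N - k)).
Definition qmultinom (r : nat) (N : nat) (b : 'I_r -> nat) : Kaq :=
  qpoch N / \prod_(i < r) qpoch (b i).

Inductive orient := UP | OP | RI.
Definition orient_eqb (X Y : orient) : bool :=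
  match X, Y with UP, UP | OP, OP | RI, RI => true | _, _ => false end.

(* An element sum_{j,X,k<=j} c X j k * X[j,k] of M, represented by its
   coefficient function c (only the values with k <= j are meaningful). *)
Definition M := orient -> nat -> nat -> Kaq.

Local Notation "x ^^ n" := (x ^ (n : int)) (at level 29, left associativity).

Definition Ttw (c : M) : M := fun Y j h =>
  if (h <= j)%N then
  match Y with
  | UP => \sum_(k < h.+1) c UP j k *
           ((- qv) ^^ (h%:Z - j%:Z) * qv ^^ (k%:Z * k%:Z) * qbin h k)
  | RI => \sum_(k < h.+1) c OP j k *
           ((- qv) ^^ h%:Z * av ^^ k%:Z * qv ^^ (k%:Z * k%:Z - 2 * j%:Z * k%:Z)
            * qbin h k)
  | OP => \sum_(k < h.+1) c RI j k *
           ((- qv) ^^ h%:Z * av ^^ h%:Z * qv ^^ (k%:Z * k%:Z - 2 * j%:Z * h%:Z)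
            * qbin h k)
  end else 0.

Definition Rtw (c : M) : M := fun Y j h =>
  if (h <= j)%N then
  match Y with
  | OP => \sum_(h <= k < j.+1) c UP j k *
           ((- qv) ^^ (h%:Z - j%:Z) * av ^^ (h%:Z - j%:Z)
            * qv ^^ (- 2 * k%:Z * h%:Z + k%:Z * k%:Z + j%:Z * j%:Z)
            * qbin (j - h) (k - h))
  | UP => \sum_(h <= k < j.+1) c OP j k *
           ((- qv) ^^ (h%:Z - j%:Z) * av ^^ (k%:Z - j%:Z)
            * qv ^^ (2 * h%:Z * (j%:Z - k%:Z) + (k%:Z - j%:Z) * (k%:Z - j%:Z))
            * qbin (j - h) (k - h))
  | RI => \sum_(h <= k < j.+1) c RI j k *
           ((- qv) ^^ h%:Z
            * qv ^^ (h%:Z * (2 * j%:Z - 2 * k%:Z) + k%:Z * k%:Z - j%:Z * j%:Z)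
            * qbin (j - h) (k - h))
  end else 0.

Definition rho (c : M) : M := fun Y j k => qbin j k * c Y j k.
Definition rhoinv (c : M) : M := fun Y j k => (qbin j k)^-1 * c Y j k.

Definition Ttilde (c : M) : M := rho (Ttw (rhoinv c)).
Definition Rtilde (c : M) : M := rho (Rtw (rhoinv c)).

Inductive letter := LT | LR.
Definition act_letter (l : letter) : M -> M :=
  match l with LT => Ttilde | LR => Rtilde end.
Definition act_word (w : seq letter) (F : M) : M :=
  foldr (fun l G => act_letter l G) F w.

Definition F0 : M := fun Y j k =>
  match Y with UP => if k == 0%N then 1 else 0 | _ => 0 end.

(* The quiver form
   sum_{d in N^{m+n}} (-q)^{S.d} a^{A.d} q^{d^T Q d} [|d| brack d] X[|d|, d_1+..+d_m],
   as an element of M: coefficient of Y[j,k] = sum over d with |d| = j and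
   d_1+...+d_m = k (d ranges over the finitely many such vectors). *)
Definition quiver_form (m n : nat) (S A : 'rV[int]_(m + n)) (Q : 'M[int]_(m + n))
  (X : orient) : M := fun Y j k =>
  if orient_eqb X Y then
    \sum_(d : {ffun 'I_(m + n) -> 'I_j.+1} |
          ((\sum_(i < m + n) (d i : nat)) == j)%N &&
          ((\sum_(i < m + n | (i < m)%N) (d i : nat)) == k)%N)
      ((- qv) ^^ (\sum_(i < m + n) S 0 i * (d i : nat)%:Z)
       * av ^^ (\sum_(i < m + n) A 0 i * (d i : nat)%:Z)
       * qv ^^ (\sum_(i < m + n) \sum_(l < m + n)
                   (d i : nat)%:Z * Q i l * (d l : nat)%:Z)
       * qmultinom j (fun i => (d i : nat)))
  else 0.

(* Main.v *)
Require Import Defs.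
From HB Require Import structures.
From mathcomp Require Import all_boot all_order all_algebra.
From mathcomp Require Import zify ring.
Import Order.TTheory GRing.Theory Num.Theory.
Set Implicit Arguments. Unset Strict Implicit. Unset Printing Implicit Defensive.
Local Open Scope ring_scope.

(** After rescaling, the q-binomials in the top twist [k -> h] become
    [j - k choose h - k] and those in the right twist become [k choose h].
    The q-Vandermonde identity expands them over all ways of splitting each
    inactive (top) or each active (right) index [d_i = alpha_i + beta_i] with
    [sum alpha_i] prescribed, and it turns the multinomial of [d] into that of
    the split vector.  The [alpha_i] become active and the [beta_i] inactive.
    All exponents, including the one produced by q-Vandermonde, are integral
    combinations of linear forms, respectively of squares of linear forms, in the
    split indices, so the quiver form persists letter by letter. *)

(** * Gaussian binomials with base [q^2] and the q-binomial theorem *)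

Section QBinomial.
Variables (F : fieldType) (q : F).
Hypothesis one_sub_exp_neq0 : forall n, 1 - q ^+ n.+1 != 0.

Definition poch (n : nat) : F := \prod_(i < n) (1 - q ^+ (2 * i.+1)).
Definition bin (N k : nat) : F := poch N / (poch k * poch (N - k)).

Lemma pochS n : poch n.+1 = poch n * (1 - q ^+ (2 * n.+1)).
Proof. by rewrite /poch big_ord_recr. Qed.

Lemma poch_neq0 n : poch n != 0.
Proof.
elim: n => [|n IHn]; first by rewrite /poch big_ord0 oner_neq0.
by rewrite pochS mulf_neq0 // mulnS one_sub_exp_neq0.
Qed.

Lemma bin_neq0 N k : bin N k != 0.
Proof. by rewrite /bin mulf_neq0 ?invr_neq0 ?mulf_neq0 ?poch_neq0. Qed.

Lemma bin_id N : bin N N = 1.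
Proof. by rewrite /bin subnn {3}/poch big_ord0 mulr1 divff ?poch_neq0. Qed.

Lemma bin_0 N : bin N 0 = 1.
Proof. by rewrite /bin subn0 {2}/poch big_ord0 mul1r divff ?poch_neq0. Qed.

Lemma bin_pascal N l : (l < N)%N ->
  bin N.+1 l.+1 = bin N l.+1 + q ^+ (2 * (N - l)) * bin N l.
Proof.
move=> ltlN; rewrite /bin subSS.
have -> : (N - l = (N - l.+1).+1)%N by lia.
rewrite !pochS.
(* After this factorization only two powers of [q] occur, and the claim is a rational identity in
   them that [field] decides. *)
have -> : q ^+ (2 * N.+1) = q ^+ (2 * (N - l.+1).+1) * q ^+ (2 * l.+1).
  by rewrite -exprD; congr (_ ^+ _); lia.
have /= := one_sub_exp_neq0 (2 * l).+1.
rewrite (_ : (2 * l).+2 = (2 * l.+1)%N); last by lia.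
have /= := one_sub_exp_neq0 (2 * (N - l.+1)).+1.
rewrite (_ : (2 * (N - l.+1)).+2 = (2 * (N - l.+1).+1)%N); last by lia.
move: (poch_neq0 N) (poch_neq0 l) (poch_neq0 (N - l.+1)).
move: (poch N) (poch l) (poch (N - l.+1)) (q ^+ _) (q ^+ _) => a b c x y.
by move=> a0 b0 c0 x0 y0; field; rewrite b0 c0 x0 y0.
Qed.

(** Both sides are the q-multinomial of [j] with parts [k], [h - k], [j - h]. *)
Lemma bin_trinomial j h k : (k <= h <= j)%N ->
  bin j h * bin h k = bin j k * bin (j - k) (h - k).
Proof.
move=> /andP[lekh lehj]; rewrite /bin (_ : (j - k - (h - k) = j - h)%N); last by lia.
move: (poch_neq0 j) (poch_neq0 h) (poch_neq0 k) (poch_neq0 (j - h))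
  (poch_neq0 (h - k)) (poch_neq0 (j - k)).
move: (poch j) (poch h) (poch k) (poch _) (poch _) (poch _) => a b c x y z.
by move=> a0 b0 c0 x0 y0 z0; field; rewrite b0 c0 x0 y0 z0.
Qed.

Lemma bin_trinomial_compl j h k : (h <= k <= j)%N ->
  bin j h * bin (j - h) (k - h) = bin j k * bin k h.
Proof. by move=> /andP[lehk lekj]; rewrite bin_trinomial ?lehk. Qed.

(** The offset [s] allows a long product to be cut into consecutive blocks; expanding the blocks
    separately yields q-Vandermonde. *)
Definition qprod (s N : nat) : {poly F} :=
  \prod_(i < N) (1 + q ^+ (2 * (s + i) + 1) *: 'X).

Lemma qprodD s N N' : qprod s (N + N') = qprod s N * qprod (s + N) N'.
Proof.
rewrite /qprod big_split_ord; congr (_ * _).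
by apply: eq_bigr => i _ /=; rewrite addnA.
Qed.

(* The odd exponents in [qprod] turn the factor [q^(l(l-1))] of the usual
   q-binomial theorem into the square [q^(l*l)]. *)
Lemma coef_qprod s N l : (qprod s N)`_l =
  if (l <= N)%N then q ^+ (l * l + 2 * s * l) * bin N l else 0.
Proof.
elim: N l => [|N IHN] l.
  rewrite /qprod big_ord0 coef1; case: l => [|l] //=.
  by rewrite bin_0 !muln0 expr0 mulr1.
have -> : qprod s N.+1 = qprod s N + q ^+ (2 * (s + N) + 1) *: (qprod s N * 'X).
  by rewrite /qprod big_ord_recr /= mulrDr mulr1 -scalerAr.
rewrite coefD coefZ coefMX !IHN; case: l => [|l] /=.
  by rewrite !bin_0 mulr0 addr0.
rewrite ltnS; case: (ltngtP l N) => [ltlN | ltNl | ->].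
- rewrite bin_pascal // mulrDr; congr (_ + _).
  rewrite [LHS]mulrA [RHS]mulrA -!exprD; congr (_ * _); congr (_ ^+ _); nia.
- by rewrite mulr0 addr0.
- rewrite !bin_id add0r !mulr1 -!exprD; congr (_ ^+ _); nia.
Qed.

End QBinomial.

(** * Integral linear and quadratic forms in the indices *)

Section Forms.

(** Forms are functions of the index vector, so that a substitution of indices is a composition. *)
Definition lin (I : finType) (L : (I -> nat) -> int) :=
  exists s : I -> int, forall d, L d = \sum_i s i * (d i)%:Z.

(* Integral combinations of squares of linear forms are the quadratic forms
   with integral symmetric matrix, i.e. with even off-diagonal coefficients. *)
Inductive quad (I : finType) : ((I -> nat) -> int) -> Prop :=
| quad_sq L of lin L : quad (fun d => L d * L d)
| quadD E E' of quad E & quad E' : quad (fun d => E d + E' d)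
| quadN E of quad E : quad (fun d => - E d)
| quad_ext E E' of quad E & E =1 E' : quad E'.

Variable I : finType.
Implicit Types (L : (I -> nat) -> int) (d : I -> nat).

Lemma lin_ext L L' : lin L -> L =1 L' -> lin L'.
Proof. by case=> s sP eqL; exists s => d; rewrite -eqL. Qed.

Lemma lin_eq L d d' : lin L -> d =1 d' -> L d = L d'.
Proof.
by case=> s sP eqd; rewrite !sP; apply: eq_bigr => i _; rewrite eqd.
Qed.

Lemma lin_coord (i : I) : lin (fun d => (d i)%:Z).
Proof.
exists (fun i' => (i' == i)%:Z) => d; rewrite (bigD1 i) //= eqxx mul1r.
by rewrite big1 ?addr0 // => i' /negPf->; rewrite mul0r.
Qed.

Lemma lin0 : lin (fun _ : I -> nat => 0).
Proof. by exists (fun _ => 0) => d; rewrite big1 // => i _; rewrite mul0r. Qed.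

Lemma linD L L' : lin L -> lin L' -> lin (fun d => L d + L' d).
Proof.
case=> s sP [s' s'P]; exists (fun i => s i + s' i) => d.
by rewrite sP s'P -big_split; apply: eq_bigr => i _; rewrite mulrDl.
Qed.

Lemma linZ (c : int) L : lin L -> lin (fun d => c * L d).
Proof.
case=> s sP; exists (fun i => c * s i) => d.
by rewrite sP mulr_sumr; apply: eq_bigr => i _; rewrite mulrA.
Qed.

Lemma linN L : lin L -> lin (fun d => - L d).
Proof. by move/(linZ (-1))/lin_ext; apply=> d; rewrite mulN1r. Qed.

Lemma linB L L' : lin L -> lin L' -> lin (fun d => L d - L' d).
Proof. by move=> linL /linN; apply: linD. Qed.

Lemma lin_sum (T : finType) (P : pred T) (L : T -> (I -> nat) -> int) :
  (forall t, lin (L t)) -> lin (fun d => \sum_(t | P t) L t d).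
Proof.
move=> linL; apply: (@lin_ext (fun d => \sum_(t <- index_enum T | P t) L t d)) => //.
elim: (index_enum T) => [|t r IHr].
  by apply: lin_ext lin0 _ => d; rewrite big_nil.
case Pt: (P t); last by apply: lin_ext IHr _ => d; rewrite big_cons Pt.
by apply: lin_ext (linD (linL t) IHr) _ => d; rewrite big_cons Pt.
Qed.

Lemma lin_sum_nat (T : finType) (P : pred T) (f : T -> (I -> nat) -> nat) :
  (forall t, lin (fun d => (f t d)%:Z)) ->
  lin (fun d => (\sum_(t | P t) f t d)%N%:Z).
Proof.
move=> linf; apply: lin_ext (lin_sum P linf) _ => d.
by rewrite (big_morph _ PoszD (erefl _)).
Qed.

Lemma lin_sum_coord (P : pred I) : lin (fun d => (\sum_(i | P i) d i)%N%:Z).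
Proof. by apply: lin_sum_nat => i; apply: lin_coord. Qed.

Lemma quad_eq (E : (I -> nat) -> int) d d' : quad E -> d =1 d' -> E d = E d'.
Proof.
move=> + eqd; elim=> {E} [L linL|E E' _ -> _ ->|E _ ->|E E' _ + eqE] //.
- by rewrite (lin_eq linL eqd).
- by rewrite !eqE.
Qed.

Lemma quad0 : quad (fun _ : I -> nat => 0).
Proof. by apply: quad_ext (quad_sq lin0) _ => d; rewrite mulr0. Qed.

Lemma quadB (E E' : (I -> nat) -> int) : quad E -> quad E' -> quad (fun d => E d - E' d).
Proof. by move=> quadE /quadN; apply: quadD. Qed.

(** Polarization: [(L + L')^2 - (L^2 + L'^2)]. The factor 2 matters, since the matrix of [L * L']
    alone may have half-integral entries. *)
Lemma quad_2mul L L' : lin L -> lin L' -> quad (fun d => 2 * (L d * L' d)).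
Proof.
move=> linL linL'.
apply: quad_ext (quadB (quad_sq (linD linL linL'))
                       (quadD (quad_sq linL) (quad_sq linL'))) _ => d /=.
ring.
Qed.

Lemma quad_sum (T : finType) (P : pred T) (E : T -> (I -> nat) -> int) :
  (forall t, quad (E t)) -> quad (fun d => \sum_(t | P t) E t d).
Proof.
move=> quadE; apply: (@quad_ext _ (fun d => \sum_(t <- index_enum T | P t) E t d)) => //.
elim: (index_enum T) => [|t r IHr].
  by apply: quad_ext quad0 _ => d; rewrite big_nil.
case Pt: (P t); last by apply: quad_ext IHr _ => d; rewrite big_cons Pt.
by apply: quad_ext (quadD (quadE t) IHr) _ => d; rewrite big_cons Pt.
Qed.

(** The square of the linear form with coefficients [s] has matrix [s i * s l]; sums and opposites
    act entrywise. *)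
Lemma quad_matrix (E : (I -> nat) -> int) : quad E ->
  exists Q : I -> I -> int, (forall i l, Q i l = Q l i) /\
    forall d, E d = \sum_i \sum_l (d i)%:Z * Q i l * (d l)%:Z.
Proof.
elim=> {E} [L [s sP]|E E' _ [Q [symQ QP]] _ [Q' [symQ' Q'P]]|E _ [Q [symQ QP]]
           |E E' _ [Q [symQ QP]] eqE].
- exists (fun i l => s i * s l); split=> [i l|d]; first by rewrite mulrC.
  rewrite sP mulr_suml; apply: eq_bigr => i _; rewrite mulr_sumr.
  by apply: eq_bigr => l _; ring.
- exists (fun i l => Q i l + Q' i l); split=> [i l|d]; first by rewrite symQ symQ'.
  rewrite QP Q'P -big_split; apply: eq_bigr => i _; rewrite -big_split.
  by apply: eq_bigr => l _ /=; ring.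
- exists (fun i l => - Q i l); split=> [i l|d]; first by rewrite symQ.
  rewrite QP -sumrN; apply: eq_bigr => i _; rewrite -sumrN.
  by apply: eq_bigr => l _; ring.
- by exists Q; split=> // d; rewrite -eqE.
Qed.

End Forms.

Lemma lin_comp (I T : finType) (f : (T -> nat) -> I -> nat) (L : (I -> nat) -> int) :
  (forall i, lin (fun d => (f d i)%:Z)) -> lin L -> lin (fun d => L (f d)).
Proof.
move=> linf [s sP].
by apply: lin_ext (lin_sum predT (fun i => linZ (s i) (linf i))) _ => d; rewrite sP.
Qed.

Lemma quad_comp (I T : finType) (f : (T -> nat) -> I -> nat) (E : (I -> nat) -> int) :
  (forall i, lin (fun d => (f d i)%:Z)) -> quad E -> quad (fun d => E (f d)).
Proof.
move=> linf; elim=> {E} [L linL|E E' _ IHE _ IHE'|E _ IHE|E E' _ IHE eqE].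
- exact: quad_sq (lin_comp linf linL).
- exact: quadD.
- exact: quadN.
- by apply: quad_ext IHE _ => d; apply: eqE.
Qed.

(** * The q-Vandermonde identity with several blocks *)

Section Vandermonde.
Variables (F : fieldType) (q : F).
Hypothesis one_sub_exp_neq0 : forall n, 1 - q ^+ n.+1 != 0.

(** Each block starts where the preceding ones end, so the blocks concatenate; the induction removes
    the last one. *)
Lemma qprod_ord_blocks n (v : 'I_n -> nat) :
  \prod_(i < n) qprod q (\sum_(i' < n | (i' < i)%N) v i') (v i) = qprod q 0 (\sum_i v i).
Proof.
elim: n v => [|n IHn] v; first by rewrite !big_ord0 /qprod big_ord0.
rewrite !big_ord_recr /= qprodD add0n -IHn; congr (_ * qprod _ _ _).
  apply: eq_bigr => i _; congr (qprod _ _ _).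
  by rewrite big_mkcond big_ord_recr /= ltnNge ltnW // addn0 -big_mkcond.
by rewrite big_mkcond big_ord_recr /= ltnn addn0; apply: eq_bigr => i _; rewrite ltn_ord.
Qed.

(** The offsets of the blocks depend on an order. Any total order serves, and the enumeration of the
    finite type supplies one. *)
Definition before (V : finType) (i i' : V) := (enum_rank i < enum_rank i')%N.

Lemma qprod_blocks (V : finType) (v : V -> nat) :
  \prod_i qprod q (\sum_(i' | before i' i) v i') (v i) = qprod q 0 (\sum_i v i).
Proof.
have bij := onW_bij _ (@enum_val_bij V).
rewrite (reindex _ (bij _)) /= [in RHS](reindex _ (bij _)) /= -qprod_ord_blocks.
apply: eq_bigr => i _; congr (qprod _ _ _).
rewrite (reindex _ (bij _)) /=; apply: eq_bigl => i'.
by rewrite /before !enum_valK.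
Qed.

(** Padding the expansions of all blocks to a common bound [j] gives them one index type, so that
    their product distributes over functions into ['I_j.+1]. *)
Lemma qprod_sum s N j : (N <= j)%N ->
  qprod q s N = \sum_(l < j.+1) (qprod q s N)`_l *: 'X^l.
Proof.
move=> leNj; apply/polyP=> l; rewrite -poly_def coef_poly; case: ltnP => // ltjl.
by rewrite coef_qprod // leqNgt (leq_ltn_trans leNj).
Qed.

(** Comparison of the coefficients of ['X^l] on the two sides of [qprod_blocks]. *)
Lemma bin_vandermonde (V : finType) (v : V -> nat) j l :
  (forall i, v i <= j)%N -> (l <= \sum_i v i)%N ->
  q ^+ (l * l) * bin q (\sum_i v i) l =
  \sum_(f : {ffun V -> 'I_j.+1} | [forall i, (f i <= v i)%N] && (\sum_i f i == l)%N)
    q ^+ (\sum_i (f i * f i + 2 * (\sum_(i' | before i' i) v i') * f i)) *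
    \prod_i bin q (v i) (f i).
Proof.
move=> levj lel; have := coef_qprod one_sub_exp_neq0 0 (\sum_i v i) l.
rewrite lel muln0 mul0n addn0 => <-; rewrite -qprod_blocks.
under eq_bigr => i _ do rewrite (qprod_sum _ (levj i)).
rewrite bigA_distr_bigA coef_sum /= [RHS]big_mkcond /=; apply: eq_bigr => f _.
rewrite scaler_prod prodrXr coefZ coefXn eq_sym.
case: (_ == l); last by rewrite andbF mulr0.
rewrite andbT mulr1; case: forallP => [lefv | /forallP].
  rewrite -prodrXr -big_split; apply: eq_bigr => i _ /=.
  by rewrite coef_qprod // lefv.
(* If [f i] exceeds [v i], the term vanishes, because the block of length [v i] has degree at most
   [v i]. *)
rewrite negb_forall => /existsP[i nlefv]; apply/eqP; rewrite prodf_seq_eq0.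
by apply/hasP; exists i; rewrite ?mem_index_enum //= coef_qprod // (negPf nlefv).
Qed.

End Vandermonde.

(** * Index vectors with split entries *)

Section Merge.
Variables (K V : finType).
Implicit Types (d : K + (V + V) -> nat).

(** [K] holds the untouched indices; the left and right copies of [V] hold the parts alpha and beta
    of the split ones. *)
Definition fuse d (i : K + V) : nat :=
  match i with
  | inl x => d (inl x)
  | inr y => d (inr (inl y)) + d (inr (inr y))
  end.

(* The exponent of [q] in [bin_vandermonde] once [q ^+ (l * l)] is divided out. *)
Definition cross d : int :=
  \sum_y (d (inr (inl y)))%:Z * (d (inr (inl y)))%:Z
  + \sum_y 2 * ((\sum_(y' | before y' y) fuse d (inr y'))%N%:Z * (d (inr (inl y)))%:Z)
  - (\sum_y d (inr (inl y)))%N%:Z * (\sum_y d (inr (inl y)))%N%:Z.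

Lemma lin_fuse i : lin (fun d => (fuse d i)%:Z).
Proof.
case: i => [x|y] /=; first exact: lin_coord.
by apply: lin_ext (linD (lin_coord _) (lin_coord _)) _ => d; rewrite PoszD.
Qed.

Lemma quad_cross : quad cross.
Proof.
apply: quadB; last by apply/quad_sq/lin_sum_nat => y; apply: lin_coord.
apply: quadD; apply: quad_sum => y; first exact/quad_sq/lin_coord.
apply: quad_2mul; last exact: lin_coord.
by apply: lin_sum_nat => y'; apply: lin_fuse.
Qed.

Lemma sum_fuse d : (\sum_i fuse d i = \sum_i d i)%N.
Proof. by rewrite !big_sumType /= big_split. Qed.

End Merge.

Local Notation natf e := (fun x => nat_of_ord (e x)).

(** * q-Vandermonde inside a sum weighted by multinomials *)

Section Split.
Variables (F : fieldType) (q : F).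
Hypothesis one_sub_exp_neq0 : forall n, 1 - q ^+ n.+1 != 0.
Hypothesis q_neq0 : q != 0.
Variables (K V : finType) (j : nat).
Implicit Types (d : {ffun K + V -> 'I_j.+1}) (e : {ffun K + (V + V) -> 'I_j.+1}).

Let poch_neq0 := poch_neq0 one_sub_exp_neq0.

(** In q-Vandermonde each factor [bin q (d y) (f y)] cancels [poch q (d y)] and leaves the
    q-factorials of the two parts in the denominator. *)
Lemma bin_split d l : (l <= \sum_y d (inr y))%N ->
  bin q (\sum_y d (inr y)) l * (\prod_i poch q (d i))^-1 =
  \sum_(e : {ffun K + (V + V) -> 'I_j.+1} |
      [forall i, fuse (natf e) i == d i] && (\sum_y e (inr (inl y)) == l)%N)
    q ^ (cross (natf e)) * (\prod_i poch q (e i))^-1.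
Proof.
move=> lel; pose h (f : {ffun V -> 'I_j.+1}) : {ffun K + (V + V) -> 'I_j.+1} :=
  [ffun x => match x with
     | inl x => d (inl x)
     | inr (inl y) => f y
     | inr (inr y) => inord (d (inr y) - f y)
     end].
pose h' e : {ffun V -> 'I_j.+1} := [ffun y => e (inr (inl y))].
(* Once [d] is fixed, a splitting [e] is determined by its alpha parts. *)
rewrite (reindex_onto h h') /=; last first.
  move=> e /andP[/forallP eqd _]; apply/ffunP=> -[x|[y|y]]; rewrite !ffunE //.
    by apply/val_inj; move/eqP: (eqd (inl x)).
  by apply/val_inj; move/eqP: (eqd (inr y)) => /= <-; rewrite addKn inordK.
have ltd n y : (d (inr y) - n < j.+1)%N by have := ltn_ord (d (inr y)); lia.
(* The inserted [q ^+ (l * l)] is the factor in q-Vandermonde; its inverse becomes the negative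
   square in [cross]. *)
have -> : bin q (\sum_y d (inr y)) l =
    (q ^+ (l * l))^-1 * (q ^+ (l * l) * bin q (\sum_y d (inr y)) l).
  by rewrite mulKf ?expf_neq0.
rewrite (bin_vandermonde one_sub_exp_neq0 (j := j)) //; last first.
  by move=> y; rewrite -ltnS.
rewrite -mulrA mulr_suml mulr_sumr; apply: eq_big => [f|f /andP[/forallP lefd /eqP suml]].
  have -> : h' (h f) == f by apply/eqP/ffunP=> y; rewrite !ffunE.
  rewrite andbT; under [in RHS]eq_bigr => y _ do rewrite ffunE.
  congr (_ && _); apply/forallP/forallP => [lefd [x|y] | eqd y] /=.
  - by rewrite ffunE.
  - by rewrite !ffunE inordK ?ltd // subnKC.
  - by move/eqP: (eqd (inr y)); rewrite /= !ffunE inordK ?ltd //= => <-; rewrite leq_addr.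
rewrite !big_sumType /= !invfM.
have hl x : h f (inl x) = d (inl x) by rewrite ffunE.
have ha y : h f (inr (inl y)) = f y by rewrite ffunE.
have hb y : h f (inr (inr y)) = (d (inr y) - f y)%N :> nat by rewrite ffunE inordK.
under [in RHS]eq_bigr => x _ do rewrite hl.
under [in X in _ = _ * (_ * (X^-1 * _))]eq_bigr => y _ do rewrite ha.
under [in X in _ = _ * (_ * (_ * X^-1))]eq_bigr => y _ do rewrite hb.
have -> : q ^ cross (natf (h f)) = (q ^+ (l * l))^-1 *
    q ^+ (\sum_y (f y * f y + 2 * (\sum_(y' | before y' y) d (inr y')) * f y)).
  rewrite exprnN exprnP -expfzDr //; congr (_ ^ _).
  (* The fused entries of [h f] are those of [d], and its alpha parts sum to [l]. *)
  have -> : cross (natf (h f)) =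
      \sum_y (h f (inr (inl y)))%:Z * (h f (inr (inl y)))%:Z
      + \sum_y 2 * ((\sum_(y' | before y' y) d (inr y'))%N%:Z * (h f (inr (inl y)))%:Z)
      - l%:Z * l%:Z.
    congr (_ + _ - _%:Z * _%:Z).
    - apply: eq_bigr => y _; congr (_ * (_%:Z * _)); apply: eq_bigr => y' _ /=.
      by rewrite ha hb subnKC.
    - by rewrite -suml; apply: eq_bigr => y _; rewrite ha.
    - by rewrite -suml; apply: eq_bigr => y _; rewrite ha.
  rewrite addrC PoszM; congr (_ + _).
  rewrite -big_split (big_morph _ PoszD (erefl _)); apply: eq_bigr => y _ /=.
  by rewrite ha PoszD !PoszM mulrA.
rewrite -!mulrA; congr (_ * (_ * _)); rewrite mulrCA; congr (_ * _).
rewrite -!prodfV -!big_split; apply: eq_bigr => y _ /=.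
rewrite /bin; move: (poch_neq0 (d (inr y))) (poch_neq0 (f y)) (poch_neq0 (d (inr y) - f y)).
move: (poch _ _) (poch _ _) (poch _ _) => x y' z x0 y0 z0.
by field; rewrite x0 y0 z0.
Qed.

(** A fused entry may exceed [j], where [inord] falls back to 0; for vectors of total [j], the only
    ones summed over, this cannot happen. *)
Definition fusef e : {ffun K + V -> 'I_j.+1} := [ffun i => inord (fuse (natf e) i)].

Lemma fusefE e : (\sum_i e i = j)%N -> forall i, fusef e i = fuse (natf e) i :> nat.
Proof.
move=> sumd i; rewrite ffunE inordK // ltnS -[X in (_ <= X)%N]sumd -sum_fuse.
by rewrite (bigD1 i) //= leq_addr.
Qed.

(** The vectors [e] are grouped by their fusion [d], and [bin_split] evaluates each group. [P] and
    [H] express the same summation range before and after splitting, [H] also fixing the alpha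
    total. *)
Lemma sum_split (w : {ffun K + V -> 'I_j.+1} -> F) (P : pred {ffun K + V -> 'I_j.+1})
    (H : pred {ffun K + (V + V) -> 'I_j.+1}) (l : {ffun K + V -> 'I_j.+1} -> nat) :
  (forall d, \sum_i d i = j -> P d -> l d <= \sum_y d (inr y))%N ->
  (forall e, \sum_i e i = j -> H e =
     P (fusef e) && (\sum_y e (inr (inl y)) == l (fusef e)))%N ->
  \sum_(d : {ffun K + V -> 'I_j.+1} | (\sum_i d i == j)%N && P d)
     w d * bin q (\sum_y d (inr y)) (l d) * (poch q j / \prod_i poch q (d i)) =
  \sum_(e : {ffun K + (V + V) -> 'I_j.+1} | (\sum_i e i == j)%N && H e)
     w (fusef e) * q ^ (cross (natf e)) * (poch q j / \prod_i poch q (e i)).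
Proof.
move=> lel HE.
rewrite [RHS](partition_big fusef (fun d => (\sum_i d i == j)%N && P d)) /=; last first.
  move=> e /andP[/eqP sumd]; rewrite HE // => /andP[-> _]; rewrite andbT.
  under eq_bigr => i _ do rewrite fusefE //.
  by rewrite sum_fuse sumd.
apply: eq_bigr => d /andP[/eqP sumd Pd].
rewrite mulrACA bin_split ?lel // mulr_sumr; apply: eq_big => [e|e /andP[/forallP eqd _]].
  apply/andP/andP => [[/forallP eqd suma] | [/andP[/eqP sumd' Hd'] /eqP <-]].
    have sumd' : (\sum_i e i = j)%N.
      by rewrite -sum_fuse -[RHS]sumd; apply: eq_bigr => i _; apply/eqP/eqd.
    have eqm : fusef e = d.
      by apply/ffunP=> i; apply/val_inj; rewrite /= fusefE //; apply/eqP/eqd.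
    by rewrite sumd' HE // eqm Pd suma !eqxx.
  move: Hd'; rewrite HE // => /andP[_ ->]; split=> //.
  by apply/forallP=> i; rewrite fusefE.
have -> : fusef e = d.
  by apply/ffunP=> i; apply/val_inj; rewrite !ffunE (eqP (eqd i)) inord_val.
exact: mulrACA.
Qed.

End Split.

(** * Quiver forms over arbitrary finite index types *)

Definition lin3 (L : int -> int -> int -> int) :=
  forall (I : finType) (j k h : (I -> nat) -> int),
    lin j -> lin k -> lin h -> lin (fun d => L (j d) (k d) (h d)).

(** The exponents of a twist are functions of [j], [k], [h], which become linear forms in the split
    indices. Stability under such substitutions excludes for instance the exponent [j * k], while
    [2 * j * k] is allowed. *)
Definition quad3 (E : int -> int -> int -> int) :=
  forall (I : finType) (j k h : (I -> nat) -> int),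
    lin j -> lin k -> lin h -> quad (fun d => E (j d) (k d) (h d)).

Section QForm.
Variables (F : fieldType) (q a : F).
Hypothesis one_sub_exp_neq0 : forall n, 1 - q ^+ n.+1 != 0.
Hypothesis q_neq0 : q != 0.
Hypothesis a_neq0 : a != 0.

Definition monom (s t e : int) : F := (- q) ^ s * a ^ t * q ^ e.

Lemma monomD s t e s' t' e' :
  monom (s + s') (t + t') (e + e') = monom s t e * monom s' t' e'.
Proof.
rewrite /monom !expfzDr ?oppr_eq0 //.
by rewrite [in RHS]mulrACA; congr (_ * _); rewrite mulrACA.
Qed.

Lemma monomDr s t e e' : monom s t (e + e') = monom s t e * q ^ e'.
Proof. by rewrite /monom expfzDr // mulrA. Qed.

Lemma monom0 s e : (- q) ^ s * q ^ e = monom s 0 e.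
Proof. by rewrite /monom expr0z mulr1. Qed.

(** Active indices are marked by the predicate [A] on any finite type, so splitting requires no
    renumbering. *)
Definition qsum (I : finType) (A : pred I) (s t e : (I -> nat) -> int) (j k : nat) : F :=
  \sum_(d : {ffun I -> 'I_j.+1} | (\sum_i d i == j)%N && (\sum_(i | A i) d i == k)%N)
    monom (s (natf d)) (t (natf d)) (e (natf d)) * (poch q j / \prod_i poch q (d i)).

Definition qform (I : finType) (A : pred I) (c : nat -> nat -> F) :=
  exists s t e, [/\ lin s, lin t, quad e &
    forall j k, (k <= j)%N -> c j k = qsum A s t e j k].

(** Relabelling serves to reassociate nested sum types and, at the end, to pass to ordinals. *)
Lemma qform_bij (I T : finType) (f : T -> I) (A : pred I) c :
  bijective f -> qform A c -> qform (fun x => A (f x)) c.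
Proof.
case=> g fK gK [s [t [e [lins lint quade cE]]]].
have bijf : bijective f by exists g.
have ling i : lin (fun d : T -> nat => (d (g i))%:Z) by apply: lin_coord.
exists (fun d => s (fun i => d (g i))), (fun d => t (fun i => d (g i))),
  (fun d => e (fun i => d (g i))).
split; [exact: (lin_comp ling) | exact: (lin_comp ling) | exact: (quad_comp ling) |].
move=> j k lekj; rewrite cE // /qsum.
pose comp (d : {ffun T -> 'I_j.+1}) : {ffun I -> 'I_j.+1} := [ffun i => d (g i)].
pose comp' (d : {ffun I -> 'I_j.+1}) : {ffun T -> 'I_j.+1} := [ffun x => d (f x)].
have bijc : bijective comp.
  by exists comp' => d; apply/ffunP=> i; rewrite !ffunE ?fK ?gK.
rewrite (reindex _ (onW_bij _ bijc)) /=; apply: eq_big => d.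
  rewrite !(reindex f (onW_bij _ bijf)) /=.
  have compE x : comp d (f x) = d x by rewrite ffunE fK.
  by under eq_bigr do rewrite compE; under [X in _ && (X == _)]eq_bigr do rewrite compE.
move=> _; congr (monom _ _ _ * (_ / _)).
- by apply: lin_eq => // i; rewrite ffunE.
- by apply: lin_eq => // i; rewrite ffunE.
- by apply: quad_eq => // i; rewrite ffunE.
- by rewrite (reindex f (onW_bij _ bijf)) /=; apply: eq_bigr => i _; rewrite ffunE fK.
Qed.

Lemma eq_qform (I : finType) (A B : pred I) c : A =1 B -> qform A c -> qform B c.
Proof.
move=> eqAB [s [t [e [lins lint quade cE]]]]; exists s, t, e; split=> // j k lekj.
by rewrite cE //; apply: eq_bigl => d; rewrite (eq_bigl _ _ eqAB).
Qed.

Lemma leq_sum_pred (I : finType) (A : pred I) (d : I -> nat) :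
  (\sum_(i | A i) d i <= \sum_i d i)%N.
Proof. by rewrite [leqRHS](bigID A) leq_addr. Qed.

Lemma sum_regroup (I : finType) (A : pred I) j (r : pred nat)
    (t : {ffun I -> 'I_j.+1} -> F) (y : nat -> F) :
  \sum_(k < j.+1 | r k)
    (\sum_(d : {ffun I -> 'I_j.+1} |
       (\sum_i d i == j)%N && (\sum_(i | A i) d i == k)%N) t d) * y k =
  \sum_(d : {ffun I -> 'I_j.+1} | (\sum_i d i == j)%N && r (\sum_(i | A i) d i)%N)
    t d * y (\sum_(i | A i) d i)%N.
Proof.
have ltA (d : {ffun I -> 'I_j.+1}) : (\sum_i d i == j)%N -> (\sum_(i | A i) d i < j.+1)%N.
  by move=> /eqP sumd; rewrite ltnS -[leqRHS]sumd leq_sum_pred.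
rewrite [RHS](partition_big (fun d : {ffun I -> 'I_j.+1} =>
  inord (\sum_(i | A i) d i) : 'I_j.+1) (fun k => r k)) /=; last first.
  by move=> d /andP[sumd rd]; rewrite inordK ?ltA.
apply: eq_bigr => k rk; rewrite mulr_suml; apply: eq_big => [d|d /andP[_ /eqP->]] //.
case sumd: (_ == j)%N => //=; apply/eqP/andP => [->|[_ /eqP<-]].
  by rewrite inord_val.
by rewrite inordK ?ltA.
Qed.

(** The common core of both twists. [V] is the block to be split, [n] its total in terms of [j] and
    [k], [l] the prescribed alpha total, [r] the range of the twist, and [B] the new active set. *)
Lemma qform_split (K V : finType) (A : pred (K + V)) (B : pred (K + (V + V)))
    (r : rel nat) (n l : nat -> nat -> nat) (S T E : int -> int -> int -> int) c c' :
  (forall d : K + V -> nat, n (\sum_i d i) (\sum_(i | A i) d i) = \sum_y d (inr y))%N ->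
  (forall j k h, k <= j -> h <= j -> r k h -> l k h <= n j k)%N ->
  (forall d h, (\sum_(i | B i) d i == h) =
     r (\sum_(i | A i) fuse d i) h &&
     (\sum_y d (inr (inl y)) == l (\sum_(i | A i) fuse d i) h))%N ->
  lin3 S -> lin3 T -> quad3 E -> qform A c ->
  (forall j h, (h <= j)%N -> c' j h =
    \sum_(k < j.+1 | r k h) c j k *
      (monom (S j k h) (T j k h) (E j k h) * bin q (n j k) (l k h))) ->
  qform B c'.
Proof.
move=> nE lel BE linS linT quadE [s [t [e [lins lint quade cE]]]] c'E.
pose jf (d : K + (V + V) -> nat) := (\sum_i d i)%N%:Z.
pose kf (d : K + (V + V) -> nat) := (\sum_(i | A i) fuse d i)%N%:Z.
pose hf (d : K + (V + V) -> nat) := (\sum_(i | B i) d i)%N%:Z.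
have linj : lin jf by apply: lin_sum_coord.
have link : lin kf by apply: lin_sum_nat => i; apply: lin_fuse.
have linh : lin hf by apply: lin_sum_coord.
have linm := @lin_fuse K V.
(* Each exponent is the old form at the fused vector plus the contribution of the twist; the power
   of [q] also receives [cross] from q-Vandermonde. *)
exists (fun d => s (fuse d) + S (jf d) (kf d) (hf d)),
  (fun d => t (fuse d) + T (jf d) (kf d) (hf d)),
  (fun d => e (fuse d) + E (jf d) (kf d) (hf d) + cross d).
split.
- by apply: linD; [apply: lin_comp | apply: linS].
- by apply: linD; [apply: lin_comp | apply: linT].
- apply: quadD; last exact: quad_cross.
  by apply: quadD; [apply: quad_comp | apply: quadE].
move=> j h lehj; rewrite c'E //.
under eq_bigr => k _ do rewrite cE ?leq_ord //.
rewrite (sum_regroup A (fun k => r k h) _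
  (fun k => monom (S j k h) (T j k h) (E j k h) * bin q (n j k) (l k h))).
pose k_ (d : {ffun K + V -> 'I_j.+1}) := (\sum_(i | A i) d i)%N.
have n_E (d : {ffun K + V -> 'I_j.+1}) : (\sum_i d i = j -> \sum_y d (inr y) = n j (k_ d))%N.
  by move=> sumd; have := nE (natf d); rewrite /= sumd => <-.
pose w (d : {ffun K + V -> 'I_j.+1}) :=
  monom (s (natf d)) (t (natf d)) (e (natf d)) *
  monom (S j (k_ d) h) (T j (k_ d) h) (E j (k_ d) h).
transitivity (\sum_(d : {ffun K + V -> 'I_j.+1} | (\sum_i d i == j)%N && r (k_ d) h)
  w d * bin q (\sum_y d (inr y)) (l (k_ d) h) * (poch q j / \prod_i poch q (d i))).
  apply: eq_bigr => d /andP[/eqP sumd _].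
  by rewrite n_E // /w -/(k_ d) mulrACA [X in _ * X = _]mulrC [LHS]mulrA.
have k_E (d : {ffun K + (V + V) -> 'I_j.+1}) : (\sum_i d i = j)%N ->
    k_ (fusef d) = (\sum_(i | A i) fuse (natf d) i)%N.
  by move=> sumd; apply: eq_bigr => i _; rewrite fusefE.
rewrite (sum_split one_sub_exp_neq0 q_neq0 w (P := fun d => r (k_ d) h)
  (H := fun d => (\sum_(i | B i) d i == h)%N)
  (l := fun d => l (k_ d) h)); first last.
- by move=> d sumd; rewrite (BE (natf d)) k_E.
- move=> d sumd rd; rewrite n_E //; apply: lel => //.
  by rewrite -[leqRHS]sumd leq_sum_pred.
apply: eq_bigr => d /andP[/eqP sumd /eqP sumB]; congr (_ * _).
rewrite /w -monomD k_E // /jf /kf /hf sumd sumB.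
rewrite (lin_eq lins (fusefE sumd)) (lin_eq lint (fusefE sumd)).
rewrite (quad_eq quade (fusefE sumd)).
by rewrite [RHS]monomDr.
Qed.

Definition is_inr (X Y : Type) (x : X + Y) := if x is inr _ then true else false.

(** The inactive block [V], of total [j - k], is split; its alpha parts, of total [h - k], join the
    active [K]. *)
Lemma qform_top (K V : finType) (S T E : int -> int -> int -> int) c c' :
  lin3 S -> lin3 T -> quad3 E -> qform (@is_inl K V) c ->
  (forall j h, (h <= j)%N -> c' j h =
    \sum_(k < h.+1) c j k *
      (monom (S j k h) (T j k h) (E j k h) * bin q (j - k) (h - k))) ->
  qform (@is_inl (K + V)%type V) c'.
Proof.
move=> linS linT quadE qc c'E.
pose f (x : K + V + V) : K + (V + V) :=
  match x with
  | inl (inl x) => inl x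
  | inl (inr y) => inr (inl y)
  | inr y => inr (inr y)
  end.
pose g (x : K + (V + V)) : K + V + V :=
  match x with
  | inl x => inl (inl x)
  | inr (inl y) => inl (inr y)
  | inr (inr y) => inr y
  end.
have bijf : bijective f by exists g => [[[]|]|[|[]]].
pose B (x : K + (V + V)) := is_inl (g x).
suff : qform B c' by move/(qform_bij bijf); apply: eq_qform => -[[]|].
refine (@qform_split K V (@is_inl K V) B leq subn (fun k h => h - k)%N S T E c c'
  _ _ _ linS linT quadE qc _).
- move=> d; rewrite !big_sumType /= big_pred0_eq addn0 addKn //.
- by move=> j k h *; apply: leq_sub2r.
- move=> d h; rewrite !big_sumType /= !big_pred0_eq !addn0.
  (* The new active total is [k] plus the alpha total, so prescribing it as [h] forces [k <= h] and
     alpha total [h - k]. *)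
  apply/eqP/andP => [<-|[lekh /eqP->]]; last exact: subnKC.
  by rewrite leq_addr addKn.
- move=> j h lehj; rewrite c'E //.
  exact: (big_ord_widen _ (fun k : nat => c j k *
    (monom (S j k h) (T j k h) (E j k h) * bin q (j - k) (h - k)))).
Qed.

(** The active block [K], of total [k], is split; its alpha parts, of total [h], stay active and its
    beta parts join the inactive [V]. *)
Lemma qform_right (K V : finType) (S T E : int -> int -> int -> int) c c' :
  lin3 S -> lin3 T -> quad3 E -> qform (@is_inl K V) c ->
  (forall j h, (h <= j)%N -> c' j h =
    \sum_(h <= k < j.+1) c j k *
      (monom (S j k h) (T j k h) (E j k h) * bin q k h)) ->
  qform (@is_inl K (V + K)%type) c'.
Proof.
move=> linS linT quadE qc c'E.
pose swap (X Y : Type) (x : X + Y) : Y + X :=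
  match x with inl x => inr x | inr y => inl y end.
have bijs : bijective (@swap V K) by exists (@swap K V) => -[].
(* [qform_split] splits the right summand, so the active block is moved there. *)
have {}qc : qform (@is_inr V K) c.
  by move/(qform_bij bijs): qc; apply: eq_qform => -[].
pose f (x : K + (V + K)) : V + (K + K) :=
  match x with
  | inl x => inr (inl x)
  | inr (inl y) => inl y
  | inr (inr x) => inr (inr x)
  end.
pose g (x : V + (K + K)) : K + (V + K) :=
  match x with
  | inr (inl x) => inl x
  | inl y => inr (inl y)
  | inr (inr x) => inr (inr x)
  end.
have bijf : bijective f by exists g => [[|[]]|[|[]]].
pose B (x : V + (K + K)) := is_inl (g x).
suff : qform B c' by move/(qform_bij bijf); apply: eq_qform => -[|[]].
refine (@qform_split V K (@is_inr V K) B geq (fun _ k => k) (fun _ h => h) S T E c c'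
  _ _ _ linS linT quadE qc _).
- by move=> d; rewrite !big_sumType /= big_pred0_eq.
- by [].
- move=> d h; rewrite !big_sumType /= !big_pred0_eq !addn0 !add0n.
  by apply/eqP/andP => [<-|[_ /eqP->]] //; rewrite big_split leq_addr eqxx.
- by move=> j h lehj; rewrite c'E // big_geq_mkord.
Qed.

End QForm.

(** * Rescaled twists, the passage to matrices, and the initial sum *)

Section Twist.
Variables (F : fieldType) (q a : F).
Hypothesis one_sub_exp_neq0 : forall n, 1 - q ^+ n.+1 != 0.
Hypothesis q_neq0 : q != 0.
Hypothesis a_neq0 : a != 0.
Local Notation bin := (bin q).
Local Notation monom := (monom q a).
Local Notation qform := (qform q a).

(** Conjugation by the rescaling trades [bin h k] for [bin (j - k) (h - k)], whose upper entry is
    the inactive total. *)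
Lemma qform_top_tilde (K V : finType) (S T E : int -> int -> int -> int)
    (x : nat -> nat -> nat -> F) c c' :
  lin3 S -> lin3 T -> quad3 E ->
  (forall j k h : nat, x j k h = monom (S j k h) (T j k h) (E j k h)) ->
  qform (@is_inl K V) c ->
  (forall j h, c' j h = bin j h *
     (if (h <= j)%N then \sum_(k < h.+1) (bin j k)^-1 * c j k * (x j k h * bin h k)
      else 0)) ->
  qform (@is_inl (K + V)%type V) c'.
Proof.
move=> linS linT quadE xE qc c'E.
apply: (qform_top one_sub_exp_neq0 q_neq0 a_neq0 linS linT quadE qc) => j h lehj.
rewrite c'E lehj mulr_sumr; apply: eq_bigr => k _.
have /= := bin_trinomial one_sub_exp_neq0 (j := j) (h := h) (k := k).
rewrite lehj -ltnS ltn_ord -xE => /(_ isT).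
move: (bin_neq0 one_sub_exp_neq0 j k).
move: (bin j k) (bin j h) (bin h k) (bin (j - k) _) => b1 b2 b3 b4 b0 e.
have -> : b4 = b2 * b3 / b1 by rewrite e mulrAC divff ?mul1r.
by field.
Qed.

(** Here the rescaling trades [bin (j - h) (k - h)] for [bin k h], whose upper entry is the active
    total. *)
Lemma qform_right_tilde (K V : finType) (S T E : int -> int -> int -> int)
    (x : nat -> nat -> nat -> F) c c' :
  lin3 S -> lin3 T -> quad3 E ->
  (forall j k h : nat, x j k h = monom (S j k h) (T j k h) (E j k h)) ->
  qform (@is_inl K V) c ->
  (forall j h, c' j h = bin j h *
     (if (h <= j)%N then
        \sum_(h <= k < j.+1) (bin j k)^-1 * c j k * (x j k h * bin (j - h) (k - h))
      else 0)) ->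
  qform (@is_inl K (V + K)%type) c'.
Proof.
move=> linS linT quadE xE qc c'E.
apply: (qform_right one_sub_exp_neq0 q_neq0 a_neq0 linS linT quadE qc) => j h lehj.
rewrite c'E lehj mulr_sumr; apply: eq_big_nat => k /andP[lehk lekj].
have /= := bin_trinomial_compl one_sub_exp_neq0 (j := j) (h := h) (k := k).
rewrite lehk -ltnS lekj -xE => /(_ isT).
move: (bin_neq0 one_sub_exp_neq0 j k).
move: (bin j k) (bin j h) (bin (j - h) _) (bin k h) => b1 b2 b3 b4 b0 e.
have -> : b4 = b2 * b3 / b1 by rewrite e mulrAC divff ?mul1r.
by field.
Qed.

Lemma tilde_sum0 (I : Type) (r : seq I) (b : F) (y c z : I -> F) (t : bool) :
  (forall k, c k = 0) ->
  b * (if t then \sum_(k <- r) y k * c k * z k else 0) = 0.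
Proof.
move=> c0; rewrite big1 => [|k _]; last by rewrite c0 mulr0 mul0r.
by case: t; rewrite mulr0.
Qed.

(** [K] is enumerated by the first [#|K|] ordinals and [V] by the rest, which puts the active
    indices first. *)
Lemma qform_quiver (K V : finType) c : qform (@is_inl K V) c ->
  exists (m n : nat) (S A : 'rV[int]_(m + n)) (Q : 'M[int]_(m + n)), Q^T = Q /\
  forall j k, (k <= j)%N -> c j k =
    \sum_(d : {ffun 'I_(m + n) -> 'I_j.+1} |
          ((\sum_(i < m + n) (d i : nat)) == j)%N &&
          ((\sum_(i < m + n | (i < m)%N) (d i : nat)) == k)%N)
      ((- q) ^ (\sum_(i < m + n) S 0 i * (d i : nat)%:Z)
       * a ^ (\sum_(i < m + n) A 0 i * (d i : nat)%:Z)
       * q ^ (\sum_(i < m + n) \sum_(l < m + n)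
                   (d i : nat)%:Z * Q i l * (d l : nat)%:Z)
       * (poch q j / \prod_(i < m + n) poch q (d i))).
Proof.
move=> qc; exists #|K|, #|V|.
pose f (i : 'I_(#|K| + #|V|)) : K + V :=
  match split i with inl x => inl (enum_val x) | inr y => inr (enum_val y) end.
pose g (x : K + V) : 'I_(#|K| + #|V|) :=
  unsplit (match x with inl x => inl (enum_rank x) | inr y => inr (enum_rank y) end).
have bijf : bijective f.
  exists g => [i|x]; rewrite /f /g.
    by rewrite -[RHS]splitK; case: (split i) => x; rewrite enum_valK.
  by rewrite unsplitK; case: x => x; rewrite enum_rankK.
have {qc} : qform (fun i : 'I_(#|K| + #|V|) => (i < #|K|)%N) c.
  move/(qform_bij bijf): qc; apply: eq_qform => i; rewrite /f.
  by case: splitP.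
case=> s [t [e [[s' s'E] [t' t'E] /quad_matrix[Q [symQ QE]] cE]]].
exists (\row_i s' i), (\row_i t' i), (\matrix_(i, l) Q i l).
split=> [|j k lekj]; first by apply/matrixP=> i l; rewrite !mxE symQ.
rewrite cE //; apply: eq_bigr => d _; congr (_ ^ _ * _ ^ _ * _ ^ _ * _).
- by rewrite s'E; apply: eq_bigr => i _; rewrite mxE.
- by rewrite t'E; apply: eq_bigr => i _; rewrite mxE.
- by rewrite QE; apply: eq_bigr => i _; apply: eq_bigr => l _; rewrite mxE.
Qed.

(** One inactive index, no active one, and zero exponents: the multinomial is then 1. *)
Lemma qform_F0 (c : nat -> nat -> F) :
  (forall j k, c j k = (k == 0%N)%:R) -> qform (@is_inl void unit) c.
Proof.
move=> cE; exists (fun _ => 0), (fun _ => 0), (fun _ => 0).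
split; [exact: lin0 | exact: lin0 | exact: quad0 |] => j k lekj.
have -> : c j k = if k == 0%N then 1 else 0 by rewrite cE; case: (_ == _).
have sumE (d : {ffun void + unit -> 'I_j.+1}) : (\sum_i d i)%N = d (inr tt).
  rewrite big_sumType /= big_pred0 => [|[]] //; rewrite add0n.
  by rewrite (big_pred1 tt) => // -[].
have sum0 (d : {ffun void + unit -> 'I_j.+1}) : (\sum_(i | is_inl i) d i)%N = 0%N.
  by rewrite big_pred0 // => -[[]|].
rewrite /qsum; under eq_bigl => d do rewrite sumE sum0 eq_sym.
case: k lekj => [|k] _; last by rewrite big_pred0 // => d; rewrite andbF.
rewrite (big_pred1 [ffun=> ord_max]) => [|d].
  rewrite -monom0 !expr0z !mul1r big_sumType /= big_pred0 => [|[]] //.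
  rewrite mul1r (big_pred1 tt) => [|[]] //.
  by rewrite ffunE /= divff // poch_neq0.
rewrite andbT eq_sym; apply/eqP/eqP => [dj|->]; last by rewrite ffunE.
by apply/ffunP=> -[[]|[]]; apply/val_inj; rewrite ffunE.
Qed.

End Twist.

(** * The field of rational functions in [a] and [q], and induction on the word *)

Lemma qv_neq0 : qv != 0.
Proof. by rewrite tofrac_eq0 polyC_eq0 polyX_eq0. Qed.

Lemma av_neq0 : av != 0.
Proof. by rewrite tofrac_eq0 polyX_eq0. Qed.

Lemma one_sub_qvX_neq0 n : 1 - qv ^+ n.+1 != 0.
Proof.
rewrite -tofracXn -tofrac1 -tofracB tofrac_eq0 -polyC_exp -polyCB polyC_eq0.
by rewrite -opprB oppr_eq0 -size_poly_eq0 size_XnsubC.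
Qed.

(** The vanishing at the other orientations is part of the invariant, since a quiver form has a
    single type [X]. *)
Definition has_qform (X : orient) (c : M) :=
  (forall Y j k, ~~ orient_eqb X Y -> c Y j k = 0) /\
  exists K V : finType, qform qv av (@is_inl K V) (c X).

Definition top_orient (X : orient) : orient :=
  match X with UP => UP | OP => RI | RI => OP end.

Definition right_orient (X : orient) : orient :=
  match X with UP => OP | OP => UP | RI => RI end.

Lemma has_qform_Ttilde X c : has_qform X c -> has_qform (top_orient X) (Ttilde c).
Proof.
case=> c0 [K [V qc]]; split.
  move=> Y j h neqY; rewrite /Ttilde /rho /Ttw /rhoinv.
  case: X c0 {qc} neqY => c0; case: Y => //= _;
    by apply: tilde_sum0 => k; apply: c0.
exists (K + V)%type, V.
case: X c0 qc => _ qc /=.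
(* This twist carries no power of [a], so its coefficient is a [monom] only after inserting
   [a ^ 0]. *)
- apply: (qform_top_tilde one_sub_qvX_neq0 qv_neq0 av_neq0
    (S := fun j k h => h - j) (T := fun _ _ _ => 0) (E := fun j k h => k * k)
    (x := fun j k h => (- qv) ^ (h%:Z - j%:Z) * qv ^ (k%:Z * k%:Z)) _ _ _ _ qc).
  + by move=> *; apply: linB.
  + by move=> *; apply: lin0.
  + by move=> *; apply: quad_sq.
  + by move=> *; apply: monom0.
  + by move=> j h.
- apply: (qform_top_tilde one_sub_qvX_neq0 qv_neq0 av_neq0
    (S := fun j k h => h) (T := fun _ k _ => k) (E := fun j k h => k * k - 2 * j * k)
    _ _ _ (fun _ _ _ => erefl) qc) => //.
  move=> I j k h lj lk lh.
  by apply: quad_ext (quadB (quad_sq lk) (quad_2mul lj lk)) _ => d; rewrite mulrA.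
- apply: (qform_top_tilde one_sub_qvX_neq0 qv_neq0 av_neq0
    (S := fun j k h => h) (T := fun _ _ h => h) (E := fun j k h => k * k - 2 * j * h)
    _ _ _ (fun _ _ _ => erefl) qc) => //.
  move=> I j k h lj lk lh.
  by apply: quad_ext (quadB (quad_sq lk) (quad_2mul lj lh)) _ => d; rewrite mulrA.
Qed.

Lemma has_qform_Rtilde X c : has_qform X c -> has_qform (right_orient X) (Rtilde c).
Proof.
case=> c0 [K [V qc]]; split.
  move=> Y j h neqY; rewrite /Rtilde /rho /Rtw /rhoinv.
  case: X c0 {qc} neqY => c0; case: Y => //= _;
    by apply: tilde_sum0 => k; apply: c0.
exists K, (V + K)%type.
case: X c0 qc => _ qc /=.
- apply: (qform_right_tilde one_sub_qvX_neq0 qv_neq0 av_neq0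
    (S := fun j k h => h - j) (T := fun j k h => h - j)
    (E := fun j k h => - 2 * k * h + k * k + j * j)
    _ _ _ (fun _ _ _ => erefl) qc) => //.
  + by move=> *; apply: linB.
  + by move=> *; apply: linB.
  + move=> I j k h lj lk lh.
    apply: quad_ext (quadD (quadB (quad_sq lk) (quad_2mul lk lh)) (quad_sq lj)) _ => d.
    ring.
- apply: (qform_right_tilde one_sub_qvX_neq0 qv_neq0 av_neq0
    (S := fun j k h => h - j) (T := fun j k h => k - j)
    (E := fun j k h => 2 * h * (j - k) + (k - j) * (k - j))
    _ _ _ (fun _ _ _ => erefl) qc) => //.
  + by move=> *; apply: linB.
  + by move=> *; apply: linB.
  + move=> I j k h lj lk lh.
    apply: quad_ext (quadD (quad_2mul lh (linB lj lk)) (quad_sq (linB lk lj))) _ => d.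
    ring.
- apply: (qform_right_tilde one_sub_qvX_neq0 qv_neq0 av_neq0
    (S := fun j k h => h) (T := fun j k h => 0)
    (E := fun j k h => h * (2 * j - 2 * k) + k * k - j * j)
    (x := fun j k h => (- qv) ^ h%:Z
            * qv ^ (h%:Z * (2 * j%:Z - 2 * k%:Z) + k%:Z * k%:Z - j%:Z * j%:Z)) _ _ _ _ qc).
  + by [].
  + by move=> *; apply: lin0.
  + move=> I j k h lj lk lh.
    apply: quad_ext (quadB (quadD (quad_2mul lh (linB lj lk)) (quad_sq lk)) (quad_sq lj)) _ => d.
    ring.
  + by move=> *; apply: monom0.
  + by move=> j h.
Qed.

Lemma has_qform_word w : exists X, has_qform X (act_word w F0).
Proof.
elim: w => [|[] w [X IHw]].
- exists UP; split; first by case.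
  exists void, unit; apply: (qform_F0 _ one_sub_qvX_neq0) => j k /=.
  by case: (k == 0%N).
- by exists (top_orient X); apply: has_qform_Ttilde.
- by exists (right_orient X); apply: has_qform_Rtilde.
Qed.

Theorem mainTheorem6 (w : seq letter) :
  exists (m n : nat) (S A : 'rV[int]_(m + n)) (Q : 'M[int]_(m + n)) (X : orient),
    Q^T = Q /\
    forall (Y : orient) (j k : nat), (k <= j)%N ->
      act_word w F0 Y j k = quiver_form S A Q X Y j k.
Proof.
have [X [c0 [K [V /qform_quiver[m [n [S [A [Q [symQ cE]]]]]]]]]] := has_qform_word w.
exists m, n, S, A, Q, X; split=> // Y j k lekj; rewrite /quiver_form.
case eqXY: (orient_eqb X Y); last by apply: c0; rewrite eqXY.
have <- : X = Y by case: X Y eqXY {c0 cE} => -[].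
exact: cE.
Qed.
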